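(* Let $A \in {\operatorname{\mathsf{TPD}}}_n(\mathbb{S}_{\max}^{\vee})$. The diagonal elements of $A$ are precisely the $\mathbb{S}_{\max}$-eigenvalues of $A$, counted with multiplicities.
   Context: Let $\Gamma$ be a divisible totally ordered abelian group, $\mathbb{T}_{\max}=\Gamma\cup\{\bot\}$ the tropical semifield (addition $\max$, multiplication $+$), and $\mathbb{S}_{\max}=\mathbb{S}_{\max}(\Gamma)$ the symmetrized tropical semiring, with zero element $\mathbf{0}$, unit element $\mathbf{1}$, minus operator $\ominus$, modulus $|\cdot|$ and balance operator $a^\circ=a\ominus a$. Every element of $\mathbb{S}_{\max}$ is positive ($c$, $c\in\Gamma$), negative ($\ominus c$), balanced ($c^\circ$) or $\mathbf{0}$; $\mathbb{S}_{\max}^\vee$ denotes the signed elements (positive, negative or $\mathbf{0}$), $\mathbb{S}_{\max}^\oplus$ the positive elements together with $\mathbf{0}$, $\mathbb{S}_{\max}^\circ$ the balanced elements. The balance relation is $a\,\nabla\, b$ iff $a\ominus b\in\mathbb{S}_{\max}^\circ$. We write $a<b$ iff $b\ominus a\in\mathbb{S}_{\max}^\oplus\setminus\{\mathbf{0}\}$. A symmetric matrix $A=(a_{ij})\in(\mathbb{S}_{\max}^\vee)^{n\times n}$ is tropical positive definite, $A\in{\operatorname{\mathsf{TPD}}}_n(\mathbb{S}_{\max}^\vee)$, if $\mathbf{0}<x^TAx$ for all $x\in(\mathbb{S}_{\max}^\vee)^n\setminus\{\mathbf{0}\}$ (equivalently $\mathbf{0}<a_{ii}$ for all $i$ and $a_{ij}^2<a_{ii}a_{jj}$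 for $i\neq j$). The determinant is $\det(A)=\bigoplus_{\pi}\mathrm{sgn}(\pi)\prod_i a_{i\pi(i)}$ with $\mathrm{sgn}(\pi)\in\{\mathbf{1},\ominus\mathbf{1}\}$. The characteristic polynomial is $P_A=\det(\mathsf{X} I\ominus A)$; an $\mathbb{S}_{\max}$-eigenvalue of $A$ is a $\gamma\in\mathbb{S}_{\max}^\vee$ with $\det(\gamma I\ominus A)\,\nabla\,\mathbf{0}$. When $P_A$ has coefficients in $\mathbb{S}_{\max}^\vee$ (which holds for ${\operatorname{\mathsf{TPD}}}$ matrices), the multiplicity of a root $r$ is defined recursively by $\mathrm{mult}_r(P)=0$ if $r$ is not a root, and otherwise $\mathrm{mult}_r(P)=1+\max\{\mathrm{mult}_r(Q): Q\text{ with coefficients in }\mathbb{S}_{\max}^\vee,\ P\,\nabla\,(\mathsf{X}\ominus r)Q\}$ (coefficientwise balance). *)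

(* Defs.v *)
From HB Require Import structures.
From mathcomp Require Import all_boot all_order all_algebra all_fingroup.
Set Implicit Arguments. Unset Strict Implicit. Unset Printing Implicit Defensive.
Import Order.TTheory GRing.Theory Num.Theory.
Local Open Scope ring_scope.

Definition div_tot_ord_group (G : porderZmodType) : Prop :=
  [/\ (forall x y : G, (x <= y) || (y <= x)),
      (forall x y z : G, x <= y -> x + z <= y + z) &
      (forall (x : G) (k : nat), (0 < k)%N -> exists y : G, y *+ k = x)].

(* SPos c = c,  SNeg c = (-) c,  SBal c = c^o,  SZero = bottom.           *)
Inductive smax (G : Type) := SZero | SPos of G | SNeg of G | SBal of G.
Arguments SZero {G}.

Section Smax.
Variable G : porderZmodType.
Notation S := (smax G).

Definition smax_eqb (a b : S) : bool :=
  match a, b with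
  | SZero, SZero => true
  | SPos x, SPos y => x == y
  | SNeg x, SNeg y => x == y
  | SBal x, SBal y => x == y
  | _, _ => false
  end.

Lemma smax_eqP : Equality.axiom smax_eqb.
Proof.
case=> [|x|x|x] [|y|y|y] /=; try by constructor.
all: by apply: (iffP eqP) => [->|[]].
Qed.

HB.instance Definition _ := hasDecEq.Build S smax_eqP.

(* modulus |a| (for a <> 0) *)
Definition smodulus (a : S) : G :=
  match a with SZero => 0 | SPos x => x | SNeg x => x | SBal x => x end.

Definition sone : S := SPos 0.

Definition sopp (a : S) : S :=
  match a with SZero => SZero | SPos x => SNeg x | SNeg x => SPos x | SBal x => SBal x end.

Definition sadd (a b : S) : S :=
  match a, b with
  | SZero, _ => b
  | _, SZero => a
  | _, _ =>
    if smodulus a < smodulus b then b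
    else if smodulus b < smodulus a then a
    else match a, b with
         | SPos x, SPos _ => SPos x
         | SNeg x, SNeg _ => SNeg x
         | _, _ => SBal (smodulus a)
         end
  end.

Definition smul (a b : S) : S :=
  match a, b with
  | SZero, _ => SZero
  | _, SZero => SZero
  | SPos x, SPos y => SPos (x + y)
  | SNeg x, SNeg y => SPos (x + y)
  | SPos x, SNeg y => SNeg (x + y)
  | SNeg x, SPos y => SNeg (x + y)
  | _, _ => SBal (smodulus a + smodulus b)
  end.

Definition ssub (a b : S) : S := sadd a (sopp b).

Definition ssigned (a : S) : bool := if a is SBal _ then false else true.
Definition sbalanced (a : S) : bool :=
  match a with SZero | SBal _ => true | _ => false end.
Definition spositive (a : S) : bool := if a is SPos _ then true else false.

Definition sbal (a b : S) : bool := sbalanced (ssub a b).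
Definition slt (a b : S) : bool := spositive (ssub b a).

Fixpoint spow (a : S) (k : nat) : S :=
  if k is k'.+1 then smul a (spow a k') else sone.

Definition ssum (I : finType) (F : I -> S) : S := \big[sadd/SZero]_(i : I) F i.

Definition sgn_perm (n : nat) (s : 'S_n) : S := if odd_perm s then sopp sone else sone.

Definition sdet (n : nat) (A : 'M[S]_n) : S :=
  \big[sadd/SZero]_(s : 'S_n) smul (sgn_perm s) (\big[smul/sone]_(i < n) A i (s i)).

Definition quad_form (n : nat) (A : 'M[S]_n) (x : 'I_n -> S) : S :=
  \big[sadd/SZero]_(i < n) \big[sadd/SZero]_(j < n) smul (smul (x i) (A i j)) (x j).

Definition TPD (n : nat) (A : 'M[S]_n) : Prop :=
  [/\ A^T = A, (forall i j, ssigned (A i j)) &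
      (forall x : 'I_n -> S, (forall i, ssigned (x i)) -> (exists i, x i != SZero) ->
          slt SZero (quad_form A x))].

Definition shift_mx (n : nat) (g : S) (A : 'M[S]_n) : 'M[S]_n :=
  \matrix_(i, j) ssub (if i == j then g else SZero) (A i j).

Definition is_seigenvalue (n : nat) (A : 'M[S]_n) (g : S) : Prop :=
  ssigned g /\ sbal (sdet (shift_mx g A)) SZero.

(* formal polynomials over S_max: coefficient lists, low degree first     *)
Definition spoly := seq S.
Definition pcoef (p : spoly) (k : nat) : S := nth SZero p k.

Definition padd (p q : spoly) : spoly :=
  mkseq (fun k => sadd (pcoef p k) (pcoef q k)) (maxn (size p) (size q)).

Definition pmul (p q : spoly) : spoly :=
  mkseq (fun k => \big[sadd/SZero]_(i < k.+1) smul (pcoef p i) (pcoef q (k - i)))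
        (size p + size q).-1.

Definition pscale (c : S) (p : spoly) : spoly := map (smul c) p.

Definition charpoly_entry (n : nat) (A : 'M[S]_n) (i j : 'I_n) : spoly :=
  if i == j then [:: sopp (A i j); sone] else [:: sopp (A i j)].

Definition scharpoly (n : nat) (A : 'M[S]_n) : spoly :=
  \big[padd/[::]]_(s : 'S_n)
     pscale (sgn_perm s) (\big[pmul/[:: sone]]_(i < n) charpoly_entry A i (s i)).

Definition peval (p : spoly) (r : S) : S :=
  \big[sadd/SZero]_(k < size p) smul (pcoef p k) (spow r k).

Definition pbal (p q : spoly) : Prop := forall k, sbal (pcoef p k) (pcoef q k).
Definition psigned (p : spoly) : Prop := forall k, ssigned (pcoef p k).

Definition proot (p : spoly) (r : S) : Prop := sbal (peval p r) SZero.

(* mult_ge r p k  <->  mult_r(p) >= k  for the recursive definition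
   mult_r(P) = 0 if r not a root, else
   1 + max { mult_r(Q) : Q signed, P nabla (X (-) r) Q }. *)
Fixpoint mult_ge (r : S) (p : spoly) (k : nat) : Prop :=
  if k is k'.+1 then
    proot p r /\
    exists q : spoly, psigned q /\ pbal p (pmul [:: sopp r; sone] q) /\ mult_ge r q k'
  else True.

Definition smultiplicity (r : S) (p : spoly) (m : nat) : Prop :=
  mult_ge r p m /\ ~ mult_ge r p m.+1.

End Smax.

(* Main.v *)
Require Import Defs.
From HB Require Import structures.
From mathcomp Require Import all_boot all_order all_algebra all_fingroup.

(* A positive definite matrix satisfies a_ij^2 < a_ii a_jj for i <> j, so in a
   determinant whose entries obey this condition the product of the diagonal entries
   strictly dominates every other permutation. Applied to g I (-) A this gives the
   eigenvalues. Applied to each minor occurring in a coefficient of the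
   characteristic polynomial, it gives the exact factorization
   P_A = prod_i (X (-) a_ii), whence the lower bound on multiplicities.
   For the upper bound, Descartes' rule of signs is used: if P balances (X (-) c) Q,
   then the coefficients of P of maximal weight |p_k| c^k have at least one sign
   change more than those of Q. A root of multiplicity m thus forces at least m + 1
   coefficients of maximal weight, whereas prod_i (X (-) a_ii) has one more than the
   number of i with a_ii = c. *)

Set Implicit Arguments. Unset Strict Implicit. Unset Printing Implicit Defensive.
Import Order.TTheory GRing.Theory.
Local Open Scope ring_scope.

(* Bundling the hypothesis lets canonical structures find the semiring on [smax G]. *)
Record totgrp := Totgrp { tg :> porderZmodType; tgP : div_tot_ord_group tg }.

(** * Totally ordered groups: compatibility of the order, halving *)

Section OrderedGroup.
Variable G : totgrp.
Implicit Types x y z t : G.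

Variant trichotomy x y : bool -> bool -> bool -> bool -> Type :=
| TriLt of x < y : trichotomy x y true false true false
| TriGt of y < x : trichotomy x y false true false true
| TriEq of x = y : trichotomy x y false false true true.

Lemma trichotomyP x y : trichotomy x y (x < y) (y < x) (x <= y) (y <= x).
Proof.
have [tot _ _] := tgP G; have cmp : (x >=< y)%O by rewrite /Order.comparable tot.
by case: (comparable_ltgtP cmp) => [h|h|h]; constructor.
Qed.

Lemma leD2r x y z : (x + z <= y + z) = (x <= y).
Proof.
have [_ mono _] := tgP G; apply/idP/idP => [/mono h|/mono //].
by have := h (- z); rewrite !addrK.
Qed.

Lemma leD2l x y z : (z + x <= z + y) = (x <= y).
Proof. by rewrite ![z + _]addrC leD2r. Qed.

Lemma ltD2r x y z : (x + z < y + z) = (x < y).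
Proof. by rewrite !lt_neqAle leD2r (inj_eq (addIr z)). Qed.

Lemma ltD2l x y z : (z + x < z + y) = (x < y).
Proof. by rewrite ![z + _]addrC ltD2r. Qed.

Lemma ltleD x y z t : x < y -> z <= t -> x + z < y + t.
Proof. by move=> xy zt; apply: (@lt_le_trans _ _ (y + z)); rewrite ?ltD2r ?leD2l. Qed.

Lemma leD x y z t : x <= y -> z <= t -> x + z <= y + t.
Proof. by move=> xy zt; apply: (@le_trans _ _ (y + z)); rewrite ?leD2r ?leD2l. Qed.

Lemma ltg_double x y : (x + x < y + y) = (x < y).
Proof.
case: (trichotomyP x y) => [h|h|->]; last by rewrite ltxx.
  by apply: ltleD => //; apply: ltW.
by apply/negP => h'; have := lt_trans h' (ltleD h (ltW h)); rewrite ltxx.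
Qed.

Lemma halve x : exists y, y + y = x.
Proof. by have [_ _ /(_ x 2%N isT) [y <-]] := tgP G; exists y; rewrite mulr2n. Qed.

End OrderedGroup.

(** * The commutative semiring structure on [smax G] *)

Definition smax_code (G : Type) (a : smax G) : option (G + (G + G)) :=
  match a with
  | SZero => None
  | SPos x => Some (inl x)
  | SNeg x => Some (inr (inl x))
  | SBal x => Some (inr (inr x))
  end.

Definition smax_decode (G : Type) (c : option (G + (G + G))) : smax G :=
  match c with
  | None => SZero
  | Some (inl x) => SPos x
  | Some (inr (inl x)) => SNeg x
  | Some (inr (inr x)) => SBal x
  end.

Lemma smax_codeK (G : Type) : cancel (@smax_code G) (@smax_decode G).
Proof. by case. Qed.

(** Semirings, and polynomials over them, are built on top of choice types. *)
HB.instance Definition _ (G : porderZmodType) := CanHasChoice (@smax_codeK G).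

(* [Some true], [Some false] and [None] stand for plus, minus and balanced. *)
Definition mk (G : Type) (s : option bool) (x : G) : smax G :=
  match s with Some true => SPos x | Some false => SNeg x | None => SBal x end.

(** Case analysis through [mk] separates sign from modulus: sums and products then obey one formula
    each, and what remains on signs is a finite check. *)
Variant smax_spec (G : Type) : smax G -> Type :=
| SmaxZero : smax_spec SZero
| SmaxMk s x : smax_spec (mk s x).

Lemma smaxP (G : Type) (a : smax G) : smax_spec a.
Proof.
case: a => [|x|x|x]; first exact: SmaxZero.
- exact: (SmaxMk (Some true)).
- exact: (SmaxMk (Some false)).
- exact: (SmaxMk None).
Qed.

Definition sign_add (s t : option bool) := if s == t then s else None.
Definition sign_mul (s t : option bool) :=
  match s, t with Some a, Some b => Some (a == b) | _, _ => None end.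

Section Semiring.
Variable G : totgrp.
Implicit Types (a b c : smax G) (x y : G).

Lemma sadd_mk s t x y :
  sadd (mk s x) (mk t y) =
  if x < y then mk t y else if y < x then mk s x else mk (sign_add s t) x.
Proof.
by case: s t => [[]|] [[]|] //=; case: (trichotomyP x y).
Qed.

Lemma smul_mk s t x y : smul (mk s x) (mk t y) = mk (sign_mul s t) (x + y).
Proof. by case: s t => [[]|] [[]|]. Qed.

Lemma sadda : associative (@sadd G).
Proof.
move=> a b c.
case: (smaxP a) => [|r x] //; case: (smaxP b) => [|s y]; first by case: (mk r x).
case: (smaxP c) => [|t z]; first by case: (mk s y) (mk r x) => [|?|?|?] [|?|?|?]; case: (sadd _ _).
rewrite !sadd_mk.
case: (trichotomyP x y) => xy; case: (trichotomyP y z) => yz;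
  rewrite /= ?sadd_mk //.
- by rewrite yz (lt_trans xy yz).
- by rewrite xy (lt_gtF yz) yz.
- by rewrite -yz ltxx xy.
- by rewrite (lt_gtF xy) xy (lt_gtF (lt_trans yz xy)) (lt_trans yz xy).
- by rewrite -yz xy (lt_gtF xy).
- by rewrite xy yz.
- by rewrite xy ltxx (lt_gtF yz) yz.
by rewrite xy -yz ltxx; case: r s t => [[]|] [[]|] [[]|].
Qed.

Lemma saddc : commutative (@sadd G).
Proof.
move=> a b; case: (smaxP a) => [|r x]; first by case: b.
case: (smaxP b) => [|s y]; first by case: (mk _ _).
rewrite !sadd_mk; case: (trichotomyP x y) => //= ->; congr mk.
by case: r s => [[]|] [[]|].
Qed.

Lemma sadd0s : left_id SZero (@sadd G). Proof. by []. Qed.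

HB.instance Definition _ := GRing.isNmodule.Build (smax G) sadda saddc sadd0s.

Lemma smula : associative (@smul G).
Proof.
move=> a b c.
case: (smaxP a) => [|r x] //; case: (smaxP b) => [|s y] //; first by case: r => [[]|].
case: (smaxP c) => [|t z]; first by rewrite smul_mk; case: r s => [[]|] [[]|].
by rewrite !smul_mk addrA; congr mk; case: r s t => [[]|] [[]|] [[]|].
Qed.

Lemma smulc : commutative (@smul G).
Proof.
move=> a b; case: (smaxP a) => [|r x]; first by case: b.
case: (smaxP b) => [|s y]; first by case: (mk _ _).
by rewrite !smul_mk [y + x]addrC; case: r s => [[]|] [[]|].
Qed.

Lemma smul1s : left_id (sone G) (@smul G).
Proof. by case=> [|x|x|x] //=; rewrite add0r. Qed.

Lemma smuldl : left_distributive (@smul G) (@sadd G).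
Proof.
move=> a b c.
case: (smaxP a) => [|r x] //; case: (smaxP b) => [|s y].
  by rewrite saddc sadd0s [smul SZero c]/= saddc sadd0s.
case: (smaxP c) => [|t z]; first by rewrite smulc [smul _ SZero]smulc [smul (mk s y) _]smulc.
rewrite !smul_mk !sadd_mk !ltD2r !(fun_if (fun a => smul a _)) !smul_mk.
by case: ifP => // _; case: ifP => // _; congr mk; case: r s t => [[]|] [[]|] [[]|].
Qed.

Lemma smul0s : left_zero SZero (@smul G). Proof. by []. Qed.

HB.instance Definition _ := GRing.Nmodule_isComNzSemiRing.Build (smax G)
  smula smulc smul1s smuldl smul0s isT.

End Semiring.

(** * Domination between moduli, and dominant diagonals *)

Section Dominance.
Variable G : totgrp.
Local Notation S := (smax G).
Implicit Types (a b c d : S) (x y : G).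

(** Comparisons of moduli, signs ignored, with zero at the bottom. [sll] is the strict one: its
    smaller side is absorbed in sums. *)
Definition sle a b := (a == 0) || (b != 0) && (smodulus a <= smodulus b).
Definition sll a b := (b != 0) && ((a == 0) || (smodulus a < smodulus b)).

Lemma mk_neq0 s x : (mk s x == 0 :> S) = false.
Proof. by case: s => [[]|]. Qed.

Lemma smodulus_mk s x : smodulus (mk s x) = x.
Proof. by case: s => [[]|]. Qed.

Lemma add_mk s t x y : mk s x + mk t y =
  if x < y then mk t y else if y < x then mk s x else mk (sign_add s t) x :> S.
Proof. exact: sadd_mk. Qed.

Lemma mul_mk s t x y : mk s x * mk t y = mk (sign_mul s t) (x + y) :> S.
Proof. exact: smul_mk. Qed.

Lemma mul_eq0 a b : (a * b == 0) = (a == 0) || (b == 0).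
Proof.
case: (smaxP a) => [|s x]; first by rewrite mul0r eqxx.
by case: (smaxP b) => [|t y]; rewrite ?mulr0 ?orbT // mul_mk !mk_neq0.
Qed.

Lemma sll_mk s t x y : sll (mk s x : S) (mk t y) = (x < y).
Proof. by rewrite /sll !mk_neq0 !smodulus_mk. Qed.

Lemma sle_mk s t x y : sle (mk s x : S) (mk t y) = (x <= y).
Proof. by rewrite /sle !mk_neq0 !smodulus_mk. Qed.

Lemma sle_refl a : sle a a.
Proof. by case: (smaxP a) => [|s x] //; rewrite sle_mk. Qed.

Lemma sllW a b : sll a b -> sle a b.
Proof.
case: (smaxP a) => [|s x] //; case: (smaxP b) => [|t y] //.
by rewrite sll_mk sle_mk => /ltW.
Qed.

Lemma sll0s a : sll 0 a = (a != 0).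
Proof. by rewrite /sll eqxx andbT. Qed.

Lemma sll_add a b : sll a b -> b + a = b.
Proof.
case: (smaxP a) => [|s x]; first by rewrite addr0.
case: (smaxP b) => [|t y] //.
by rewrite sll_mk add_mk => h; rewrite (lt_gtF h) h.
Qed.

Lemma sllD a b c : sll a c -> sll b c -> sll (a + b) c.
Proof.
case: (smaxP a) => [|s x]; first by rewrite add0r.
case: (smaxP b) => [|t y]; first by rewrite addr0.
case: (smaxP c) => [|u z] //.
by rewrite add_mk !sll_mk => xz yz; case: ifP => _; [|case: ifP => _]; rewrite sll_mk.
Qed.

Lemma sleM a b c d : sle a b -> sle c d -> sle (a * c) (b * d).
Proof.
case: (smaxP a) => [|s x]; first by rewrite mul0r.
case: (smaxP c) => [|t y]; first by rewrite mulr0.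
case: (smaxP b) => [|u z]; first by rewrite /sle mk_neq0.
case: (smaxP d) => [|v w]; first by move=> _; rewrite /sle mk_neq0.
by rewrite !mul_mk !sle_mk; apply: leD.
Qed.

Lemma sllM a b c d : sll a b -> sle c d -> d != 0 -> sll (a * c) (b * d).
Proof.
case: (smaxP b) => [|u z] // + + nd.
case: (smaxP a) => [|s x]; first by rewrite mul0r !sll0s mul_eq0 negb_or nd mk_neq0.
case: (smaxP c) => [|t y]; first by rewrite mulr0 sll0s mul_eq0 negb_or nd mk_neq0.
case: (smaxP d) nd => [|v w] // _.
by rewrite !mul_mk sll_mk sle_mk sll_mk; apply: ltleD.
Qed.

Lemma sll_sle_trans b a c : sll a b -> sle b c -> sll a c.
Proof.
case: (smaxP b) => [|t y] //; case: (smaxP c) => [|u z]; first by rewrite /sle mk_neq0.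
case: (smaxP a) => [|s x]; first by rewrite !sll0s !mk_neq0.
by rewrite !sll_mk sle_mk; apply: lt_le_trans.
Qed.

Lemma sll_sqr a b : sll (a * a) (b * b) = sll a b.
Proof.
case: (smaxP a) => [|s x]; first by rewrite mul0r !sll0s mul_eq0 orbb.
case: (smaxP b) => [|t y]; first by rewrite mul0r.
by rewrite !mul_mk !sll_mk ltg_double.
Qed.

Lemma prod_neq0 (I : finType) (P : pred I) (F : I -> S) :
  (forall i, P i -> F i != 0) -> \prod_(i | P i) F i != 0.
Proof.
by move=> F0; elim/big_ind: _ => // a b a0 b0; rewrite mul_eq0 negb_or a0.
Qed.

Lemma sll_prod (I : finType) (F H : I -> S) i0 :
    (forall i, sle (F i) (H i)) -> (forall i, H i != 0) -> sll (F i0) (H i0) ->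
  sll (\prod_i F i) (\prod_i H i).
Proof.
move=> FH H0 FH0; rewrite (bigD1 i0) //= [\prod_i H i](bigD1 i0) //=.
apply: sllM => //; last exact: prod_neq0.
by elim/big_ind2: _ => // [|a b c d]; [exact: sle_refl|exact: sleM].
Qed.

(* Squaring lets each off-diagonal factor of a permutation product be compared
   with the two diagonal entries on its row and column. *)
Lemma sdet_dominant n (B : 'M[S]_n) :
    (forall i, B i i != 0) ->
    (forall i j, i != j -> sll (B i j * B i j) (B i i * B j j)) ->
  sdet B = \prod_i B i i.
Proof.
move=> B0 Bll; rewrite /sdet -[LHS]/(\sum_(s : 'S_n) sgn_perm G s * \prod_i B i (s i)).
rewrite (bigD1 1%g) //= /sgn_perm odd_perm1 -[sone G]/(1 : S) mul1r.
rewrite (eq_bigr (fun i => B i i)) => [|i _]; last by rewrite perm1.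
apply: sll_add; elim/big_ind: _ => [||s s1].
- by rewrite sll0s prod_neq0.
- by move=> a b; apply: sllD.
have [i0 si0] : exists i, s i != i.
  apply/existsP; apply: contraNT s1 => /existsPn s1; apply/eqP/permP => i.
  by rewrite perm1; apply/eqP/negbNE/s1.
have : sll (\prod_i B i (s i)) (\prod_i B i i).
  (* One of the two copies of the diagonal product is reindexed along [s], which makes the
     comparison factorwise; it is strict at the moved point [i0]. *)
  rewrite -sll_sqr -big_split [X in sll _ (_ * X)](reindex_inj (@perm_inj _ s)) -big_split.
  apply: (@sll_prod _ _ _ i0) => [i|i|] /=; last by apply: Bll; rewrite eq_sym.
    by have [<-|] := eqVneq i (s i); [exact: sle_refl|move/Bll/sllW].
  by rewrite mul_eq0 negb_or !B0.
case: (\prod_i B i (s i)) => [|x|x|x]; rewrite ?mulr0 //;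
by case: ifP => _; rewrite /sll /= ?add0r.
Qed.

End Dominance.

(** * Entrywise consequences of positive definiteness *)

Section PositiveDefinite.
Variables (G : totgrp) (n : nat) (A : 'M[smax G]_n).
Local Notation S := (smax G).
Hypothesis A_TPD : TPD A.

Lemma quad_formE (x : 'I_n -> S) :
  quad_form A x = \sum_i x i * \sum_j A i j * x j.
Proof.
rewrite /quad_form -[LHS]/(\sum_i \sum_j x i * A i j * x j).
by apply: eq_bigr => i _; rewrite mulr_sumr; apply: eq_bigr => j _; rewrite mulrA.
Qed.

Lemma TPD_pos (x : 'I_n -> S) i : (forall i, ssigned (x i)) -> x i != 0 ->
  spositive (\sum_i x i * \sum_j A i j * x j).
Proof.
case: A_TPD => _ _ pos sx xi0.
have := pos x sx (ex_intro _ i xi0).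
by rewrite /slt quad_formE /ssub -[sadd _ _]/(_ + (0 : S)) addr0.
Qed.

(** The quadratic form at the [i]-th unit vector is [A i i]. *)
Lemma TPD_diag i : exists x, A i i = SPos x.
Proof.
pose x j : S := if j == i then 1 else 0.
have xi0 : x i != 0 by rewrite /x eqxx.
have sx j : ssigned (x j) by rewrite /x; case: ifP.
have := TPD_pos sx xi0.
have x_sum (F : 'I_n -> S) : (forall j, j != i -> F j = 0) -> \sum_j F j = F i.
  by move=> F0; rewrite (bigD1 i) //= big1 ?addr0.
rewrite x_sum => [|j ji]; last by rewrite /x (negbTE ji) mul0r.
rewrite x_sum => [|j ji]; last by rewrite /x (negbTE ji) mulr0.
rewrite /x eqxx mul1r mulr1; by case: (A i i) => // y; exists y.
Qed.

(* The test vector has entries of moduli a_jj / 2 at i and a_ii / 2 at j, which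
   balances the two diagonal terms; the sign at j makes the cross term negative. *)
Lemma TPD_offdiag i j : i != j -> sll (A i j * A i j) (A i i * A j j).
Proof.
move=> ij; case: A_TPD => sym sgn _.
have [[x Ax] [y Ay]] := (TPD_diag i, TPD_diag j).
have [Aij0|[s [z Aij]]] : A i j = 0 \/ exists s z, A i j = mk (Some s) z.
  have := sgn i j; case: (A i j) => [|z|z|z] // _; first by left.
    by right; exists true, z.
  by right; exists false, z.
  by rewrite Aij0 mul0r sll0s Ax Ay.
have Aji : A j i = mk (Some s) z by rewrite -sym mxE.
rewrite Aij Ax Ay mul_mk -[SPos x * _]/(mk (Some true) (x + y)) sll_mk.
have [[hx xE] [hy yE]] := (halve x, halve y).
pose v k : S := if k == i then SPos hy else if k == j then mk (Some (~~ s)) hx else 0.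
have vE : (v i = SPos hy) * (v j = mk (Some (~~ s)) hx).
  by rewrite /v !eqxx eq_sym (negbTE ij).
have v_sum (F : 'I_n -> S) : (forall k, k != i -> k != j -> F k = 0) ->
    \sum_k F k = F i + F j.
  move=> F0; rewrite (bigD1 i) //= (bigD1 j) 1?eq_sym //= big1 ?addr0 //.
  by move=> k /andP[ki kj]; exact: F0.
have v0 k : k != i -> k != j -> v k = 0.
  by move=> /negbTE ki /negbTE kj; rewrite /v ki kj.
have sv k : ssigned (v k).
  by rewrite /v; case: ifP => // _; case: ifP => // _; case: (s).
have vi0 : v i != 0 by rewrite vE.
have := TPD_pos sv vi0.
rewrite v_sum => [|k ki kj]; last by rewrite v0 // mul0r.
rewrite !v_sum => [|k ki kj|k ki kj]; try by rewrite v0 // mulr0.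
rewrite !vE Aij Aji Ax Ay -[SPos hy]/(mk (Some true) hy) -[SPos x]/(mk (Some true) x).
rewrite -[SPos y]/(mk (Some true) y) !mulrDr !mul_mk.
have -> : hy + (x + hy) = x + y by rewrite addrCA yE.
have -> : hx + (y + hx) = x + y by rewrite addrCA xE addrC.
have -> : hx + (z + hy) = hy + (z + hx) by rewrite addrCA addrC [hx + hy]addrC addrA addrAC.
have hxy : (hx + hy) + (hx + hy) = x + y by rewrite addrACA xE yE.
(* Here [hx + hy] is half of [x + y]. If [z] equals it, all terms have modulus [x + y] and both
   signs occur, so the form is balanced; if [z] is larger, the negative cross terms dominate. Both
   contradict positivity. *)
rewrite -{3}hxy ltg_double; case: (trichotomyP z (hx + hy)) => // zxy; last first.
  have -> : hy + (z + hx) = x + y by rewrite zxy addrCA [hy + hx]addrC hxy.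
  by case: (s); do 3 rewrite ?add_mk ?ltxx.
have c_gt : x + y < hy + (z + hx).
  by rewrite addrCA [hy + hx]addrC -hxy ltD2r.
have addr_c t u : mk t (hy + (z + hx)) + mk u (x + y) = mk t (hy + (z + hx)) :> S.
  by apply: sll_add; rewrite sll_mk.
have c_addr t u : mk u (x + y) + mk t (hy + (z + hx)) = mk t (hy + (z + hx)) :> S.
  by rewrite addrC addr_c.
rewrite addr_c c_addr add_mk ltxx.
by case: (s).
Qed.

End PositiveDefinite.

(** * The balance relation, and the passage from coefficient lists to [{poly S}] *)

Section Balance.
Variable G : totgrp.
Local Notation S := (smax G).
Implicit Types (a b g r : S) (p q : spoly G).

Lemma sbal0 a : sbal a SZero = sbalanced a.
Proof. by rewrite /sbal /ssub -[sadd _ _]/(a + 0) addr0. Qed.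

Lemma sbalxx a : sbal a a.
Proof. by case: a => [|x|x|x]; rewrite /sbal /ssub /= ?ltxx. Qed.

Lemma sbalancedM a b : sbalanced (a * b) = sbalanced a || sbalanced b.
Proof. by case: a b => [|x|x|x] [|y|y|y]. Qed.

Lemma sbalanced_prod (I : finType) (F : I -> S) :
  sbalanced (\prod_i F i) = [exists i, sbalanced (F i)].
Proof.
by rewrite (big_morph _ sbalancedM (erefl : sbalanced (1 : S) = false)) big_orE.
Qed.

Lemma ssub_diagP g x : ssigned g -> sbalanced (ssub g (SPos x)) = (g == SPos x).
Proof.
case: g => [|y|y|y] //= _; rewrite /ssub /=; last first.
  by case: trichotomyP => //= h; rewrite ?h ?ltxx.
rewrite -[RHS]/(y == x); case: (trichotomyP y x) => h; first by rewrite lt_eqF.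
  by rewrite gt_eqF.
by rewrite h eqxx.
Qed.

Lemma ssub_neq0 g x : ssub g (SPos x) != 0.
Proof.
case: (smaxP g) => [|s y] //; rewrite /ssub -[sadd _ _]/(mk s y + mk (Some false) x).
by rewrite add_mk; case: ifP => _; [|case: ifP => _]; rewrite mk_neq0.
Qed.

(** Moduli never cancel. Shifting the diagonal by [g] therefore preserves its domination over the
    other entries. *)
Lemma sle_ssub g x : sle (SPos x) (ssub g (SPos x)).
Proof.
case: (smaxP g) => [|s y]; first by rewrite (@sle_mk _ (Some true) (Some false)).
rewrite /ssub -[sadd _ _]/(mk s y + mk (Some false) x) add_mk -[SPos x]/(mk (Some true) x).
have le_mk t z : x <= z -> sle (mk (Some true) x : S) (mk t z) by rewrite sle_mk.
by case: (trichotomyP y x) => h; apply: le_mk; rewrite ?h // ltW.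
Qed.

(** [Poly] turns the list operations into those of a semiring, where the general laws of sums and
    products apply, and erases trailing zeros. *)
Lemma Poly_padd p q : Poly (padd p q) = Poly p + Poly q :> {poly S}.
Proof.
apply/polyP => k; rewrite coefD !coef_Poly.
have [ks|sk] := ltnP k (maxn (size p) (size q)); first by rewrite nth_mkseq.
rewrite !nth_default ?size_mkseq ?addr0 //; apply: leq_trans sk;
  by rewrite ?leq_maxl ?leq_maxr.
Qed.

Lemma Poly_pscale a p : Poly (pscale a p) = a%:P * Poly p :> {poly S}.
Proof.
apply/polyP => k; rewrite coefCM !coef_Poly.
have [ks|sk] := ltnP k (size p); first by rewrite (nth_map 0).
by rewrite !nth_default ?size_map ?mulr0.
Qed.

Lemma Poly_pmul p q : Poly (pmul p q) = Poly p * Poly q :> {poly S}.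
Proof.
apply/polyP => k; rewrite coefM coef_Poly.
under eq_bigr => i _ do rewrite !coef_Poly.
have [ks|sk] := ltnP k (size p + size q).-1; first by rewrite nth_mkseq.
(* Past the length bound, each term of the convolution has an index beyond the end of [p] or of
   [q]. *)
rewrite nth_default ?size_mkseq // big1 // => i _.
have [pi|ip] := ltnP i (size p); last by rewrite nth_default ?mul0r.
have ik : (i <= k)%N by rewrite -ltnS.
have kq : (size q <= k - i)%N.
  rewrite leq_subRL // -ltnS -addSn.
  apply: (@leq_trans (size p + size q)); first by rewrite leq_add2r.
  by rewrite (leq_trans (leqSpred _)) ?ltnS.
by rewrite [q`_(k - i)]nth_default ?mulr0.
Qed.

Lemma spowE r k : spow r k = r ^+ k.
Proof. by elim: k => //= k ->; rewrite exprS. Qed.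

Lemma pevalE p r : peval p r = (Poly p).[r].
Proof.
rewrite (horner_coef_wide _ (size_Poly p)) /peval -[LHS]/(\sum_(k < _) pcoef p k * spow r k).
by apply: eq_bigr => k _; rewrite spowE coef_Poly.
Qed.

End Balance.

(** * Factorization of the characteristic polynomial, and the eigenvalues *)

Section CharacteristicPolynomial.
Variables (G : totgrp) (n : nat) (A : 'M[smax G]_n).
Local Notation S := (smax G).
Hypothesis A_TPD : TPD A.

(** Writing the coefficient of ['X] as the Boolean [i == s i] gives diagonal and off-diagonal
    factors the same shape. *)
Lemma Poly_scharpoly_sum :
  Poly (scharpoly A) = \sum_(s : 'S_n) (sgn_perm G s)%:P *
    \prod_i ((i == s i)%:R%:P * 'X + (sopp (A i (s i)))%:P) :> {poly S}.
Proof.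
rewrite /scharpoly (big_morph _ (@Poly_padd G) (erefl : Poly [::] = 0 :> {poly S})).
apply: eq_bigr => s _; rewrite Poly_pscale; congr (_ * _).
have Poly1 : Poly [:: sone G] = 1 :> {poly S}.
  by apply/polyP => k; rewrite coef_Poly coef1; case: k => [|[]].
rewrite (big_morph _ (@Poly_pmul G) Poly1); apply: eq_bigr => i _.
apply/polyP => k; rewrite coef_Poly coefD coefCM coefX coefC /charpoly_entry.
by case: eqP => _; case: k => [|[|k]] /=;
  rewrite ?mul0r ?mulr0 ?add0r ?mulr1 ?addr0 // nth_nil.
Qed.

(** [J] collects the factors from which the term in ['X] is chosen. *)
Lemma prod_linear_expand (F : 'I_n -> S) (H : 'I_n -> S) :
  \prod_i ((F i)%:P * 'X + (H i)%:P) =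
  \sum_(J in {set 'I_n}) (\prod_i (if i \in J then F i else H i))%:P *
    \prod_i (if i \in J then 'X else 1).
Proof.
rewrite bigA_distr; apply: eq_bigr => J _.
rewrite rmorph_prod -big_split; apply: eq_bigr => i _ /=.
by case: ifP => _; rewrite ?mulr1.
Qed.

(** With identity rows on [J], the determinant is the principal minor of minus [A] on the complement
    of [J]: the share of [J] in the coefficient of degree [#|J|]. *)
Definition minor_mx (J : {set 'I_n}) : 'M[S]_n :=
  \matrix_(i, j) if i \in J then (i == j)%:R else sopp (A i j).

(* A permutation that moves a point of [J] contributes zero, so the columns in
   [J] may be cleared as well, which makes the matrix diagonally dominant. *)
Lemma sdet_minor (J : {set 'I_n}) :
  sdet (minor_mx J) = \prod_i minor_mx J i i.
Proof.
pose D : 'M[S]_n := \matrix_(i, j)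
  if (i \in J) || (j \in J) then (i == j)%:R else sopp (A i j).
have DE i : D i i = minor_mx J i i by rewrite !mxE orbb.
have diag0 i : minor_mx J i i != 0.
  rewrite mxE eqxx; case: ifP => // _; have [x ->] := TPD_diag A_TPD i; exact: isT.
have oppM a b : sopp a * sopp b = a * b :> S by case: a b => [|x|x|x] [|y|y|y].
rewrite -(eq_bigr _ (fun i _ => DE i)) -sdet_dominant; last first.
- move=> i j ij; rewrite !mxE (negbTE ij) !eqxx !orbb.
  case: ifP => [_|/norP[/negbTE-> /negbTE->]]; last by rewrite !oppM; exact: TPD_offdiag.
  rewrite mul0r sll0s mul_eq0 negb_or.
  by have := diag0 i; have := diag0 j; rewrite !mxE !eqxx => -> ->.
- by move=> i; rewrite DE.
rewrite /sdet; apply: eq_bigr => s _; congr smul.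
rewrite -[LHS]/(\prod_i minor_mx J i (s i)) -[RHS]/(\prod_i D i (s i)).
have [/forall_inP fixJ|/forall_inPn[i iJ si]] := boolP [forall i in J, s i == i].
  apply: eq_bigr => i _; rewrite !mxE; case: ifP => //= iJ.
  case: ifP => // siJ; have /eqP/perm_inj si := fixJ _ siJ.
  by rewrite si iJ in siJ.
by rewrite (bigD1 i) // [RHS](bigD1 i) //= !mxE iJ eq_sym (negbTE si) !mul0r.
Qed.

(** Both sides are expanded over the subsets [J]. For fixed [J] the permutations sum to the
    determinant of [minor_mx J], which [sdet_minor] reduces to its diagonal product. *)
Lemma Poly_scharpoly :
  Poly (scharpoly A) = \prod_i ('X + (sopp (A i i))%:P) :> {poly S}.
Proof.
rewrite Poly_scharpoly_sum.
transitivity (\sum_(J in {set 'I_n}) (\prod_i minor_mx J i i)%:P *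
    \prod_i (if i \in J then 'X else 1) : {poly S}); last first.
  rewrite -(eq_bigr _ (fun i _ => congr1 (fun p => p + _) (mul1r 'X))).
  rewrite (prod_linear_expand (fun=> 1) (fun i => sopp (A i i))).
  apply: eq_bigr => J _; congr (_%:P * _); apply: eq_bigr => i _.
  by rewrite mxE eqxx.
under eq_bigr => s _ do
  rewrite (prod_linear_expand (fun i => (i == s i)%:R) (fun i => sopp (A i (s i)))) mulr_sumr.
rewrite exchange_big /=; apply: eq_bigr => J _.
rewrite -sdet_minor -[sdet _]/(\sum_(s : 'S_n) sgn_perm G s * \prod_i minor_mx J i (s i)).
rewrite rmorph_sum mulr_suml; apply: eq_bigr => s _.
rewrite mulrA -polyCM; congr ((_ * _)%:P * _).
by apply: eq_bigr => i _; rewrite mxE.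
Qed.

Lemma sdet_shift (g : S) : sdet (shift_mx g A) = \prod_i ssub g (A i i).
Proof.
rewrite sdet_dominant => [|i|i j ij].
- by apply: eq_bigr => i _; rewrite mxE eqxx.
- by rewrite mxE eqxx; have [x ->] := TPD_diag A_TPD i; exact: ssub_neq0.
rewrite !mxE !eqxx (negbTE ij); have := TPD_offdiag A_TPD ij.
have [[x ->] [y ->]] := (TPD_diag A_TPD i, TPD_diag A_TPD j).
have -> : ssub SZero (A i j) * ssub SZero (A i j) = A i j * A i j by case: (A i j).
by move/sll_sle_trans; apply; apply: sleM; exact: sle_ssub.
Qed.

(** A product is balanced exactly when some factor is, and for signed [g] the factor
    [ssub g (A i i)] is balanced exactly when [g] equals [A i i]. *)
Lemma is_seigenvalueE (g : S) :
  is_seigenvalue A g <-> exists i, A i i = g.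
Proof.
have sgnA i : ssigned (A i i) by have [x ->] := TPD_diag A_TPD i.
have balE i : ssigned g -> sbalanced (ssub g (A i i)) = (A i i == g).
  by move=> sg; have [x ->] := TPD_diag A_TPD i; rewrite ssub_diagP // eq_sym.
rewrite /is_seigenvalue sbal0 sdet_shift sbalanced_prod; split.
  by move=> [sg /existsP[i]]; rewrite balE // => /eqP; exists i.
move=> [i <-]; split=> //; apply/existsP; exists i.
by have [x ->] := TPD_diag A_TPD i; rewrite ssub_diagP.
Qed.

End CharacteristicPolynomial.

(** * Descartes' rule of signs for coefficients of maximal weight *)

Section Alternation.
Variable G : totgrp.
Local Notation S := (smax G).
Implicit Types (a b : S) (x y c M : G) (f g : nat -> S) (s : bool).

Lemma sleD a b M : sle a (SPos M) -> sle b (SPos M) -> sle (a + b) (SPos M).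
Proof.
case: (smaxP a) => [|s x]; first by rewrite add0r.
case: (smaxP b) => [|t y]; first by rewrite addr0.
rewrite add_mk -[SPos M]/(mk (Some true) M) !sle_mk => xM yM.
by case: ifP => _; [|case: ifP => _]; rewrite sle_mk.
Qed.

Lemma sbal_signed a b : ssigned a -> ssigned b -> sbal a b -> a = b.
Proof.
case: a b => [|x|x|x] [|y|y|y] // _ _; rewrite /sbal /ssub /=;
  by case: (trichotomyP x y) => //= ->.
Qed.

(** A signed element balancing [SBal y] has modulus at most [y]; between signed elements balance is
    equality. *)
Lemma sbal_sle a b M : ssigned a -> sbal a b -> sle b (SPos M) -> sle a (SPos M).
Proof.
case: (boolP (ssigned b)) => [sb sa /(sbal_signed sa sb) -> //|].
case: b => // y _; case: a => [|x|x|x] // _; rewrite /sbal /ssub /=;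
  case: (trichotomyP x y) => //= + _; rewrite -![SPos _]/(mk (Some true) _);
  rewrite -?[SNeg _]/(mk (Some false) _) -?[SBal _]/(mk None _) !sle_mk;
  by [move/ltW/le_trans; apply|move->].
Qed.

Lemma sbalM a b u : sbal a b -> sbal (a * u) (b * u).
Proof.
have opp_mul d : sopp d * u = sopp (d * u) by case: d u => [|x|x|x] [|y|y|y].
rewrite /sbal /ssub -[sadd (a * u) _]/(a * u + _) -opp_mul -mulrDl sbalancedM.
by rewrite -[sadd a _]/(a + _) => ->.
Qed.

(* [f] is a coefficient sequence already rescaled by the powers of the root, so that
   its entries of modulus [M] are those of maximal weight; there are [m + 1] of them. *)
Fixpoint alternates f M m lo s : Prop :=
  exists k, [/\ (lo <= k)%N, f k = mk (Some s) M &
    if m is m'.+1 then alternates f M m' k.+1 (~~ s) else True].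

Lemma alternatesW f M m lo lo' s : (lo' <= lo)%N ->
  alternates f M m lo s -> alternates f M m lo' s.
Proof. by case: m => [|m] le [k [lk fk H]]; exists k; split=> //; apply: leq_trans lk. Qed.

Lemma alternates_first f M m lo s : alternates f M m lo s ->
  exists k, [/\ (lo <= k)%N, f k = mk (Some s) M & alternates f M m k s].
Proof. by case: m => [|m] [k [lk fk H]]; exists k; split=> //; exists k. Qed.

Lemma alternates_spread f M m lo s : alternates f M m lo s ->
  exists i j s', [/\ (lo <= i)%N, (i + m <= j)%N, f i = mk (Some s) M & f j = mk (Some s') M].
Proof.
elim: m lo s => [|m IH] lo s [k [lk fk]] /=; first by exists k, k, s; rewrite addn0.
move=> /IH[i [j [s' [ki ij fi fj]]]]; exists k, j, s'; split=> //.
by apply: leq_trans ij; rewrite addnS -addSn leq_add2r.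
Qed.

(** The other term is either smaller or, after the flip by [SNeg c], of the same sign. The sum is
    thus signed, and a signed element balancing it must equal it. *)
Lemma lead_term c M s a : ssigned a -> sle a (SPos M) -> a != mk (Some s) M ->
  SPos c * mk (Some s) M + SNeg c * a = mk (Some s) (c + M) /\
  SPos c * a + SNeg c * mk (Some s) M = mk (Some (~~ s)) (c + M).
Proof.
rewrite -[SPos c]/(mk (Some true) c) -[SNeg c]/(mk (Some false) c) !mul_mk.
case: (smaxP a) => [_ _ _|[t|] z] //; first by rewrite !mulr0 addr0 add0r; case: s.
move=> _; rewrite -[SPos M]/(mk (Some true) M) sle_mk !mul_mk !add_mk !ltD2l.
case: (trichotomyP z M) => // -> _ neq.
by case: s t neq => [] [] /eqP.
Qed.

Lemma last_before f (v : S) i j : f i = v -> f j <> v -> (i < j)%N ->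
  exists k, [/\ (i <= k)%N, (k < j)%N, f k = v & f k.+1 != v].
Proof.
elim: j => // j IH fi fj; rewrite ltnS leq_eqVlt => /predU1P[ij|ij].
  by subst j; exists i; split=> //; apply/eqP.
have [fjv|fjv] := eqVneq (f j) v; first by exists j; split=> //; [exact: ltnW|apply/eqP].
have [k [ik kj fk fk1]] := IH fi (elimN eqP fjv) ij.
by exists k; split=> //; apply: ltnW.
Qed.

Section MultiplyByLinear.
Variables (f g : nat -> S) (c M : G) (N : nat).
Hypothesis f_signed : forall k, ssigned (f k).
Hypothesis g_signed : forall k, ssigned (g k).
Hypothesis f_fin : forall k, (N <= k)%N -> f k = 0.
Hypothesis f_bound : forall k, sle (f k) (SPos M).
(** This is balance with the product of [f] by [X (-) c]. Rescaling degree [k] by the [k]-th power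
    of the root puts the factor [c] on both terms. *)
Hypothesis g_bal : forall k,
  sbal (g k) (SPos c * (if k is k'.+1 then f k' else 0) + SNeg c * f k).

Lemma linear_bound k : sle (g k) (SPos (c + M)).
Proof.
have scale t a : sle a (SPos M) -> sle (mk (Some t) c * a) (SPos (c + M)).
  move=> aM; rewrite -[SPos _]/(SPos c * SPos M : S); apply: sleM => //.
  by rewrite -[SPos c]/(mk (Some true) c) sle_mk.
apply: sbal_sle (g_bal k) _ => //; apply: sleD.
  by apply: (scale true); case: (k).
exact: (scale false).
Qed.

Lemma lead_right k s : f k = mk (Some s) M -> f k.+1 != mk (Some s) M ->
  g k.+1 = mk (Some s) (c + M).
Proof.
move=> fk fk1; have [E _] := lead_term c (f_signed k.+1) (f_bound k.+1) fk1.
apply: sbal_signed => //; first by case: s {fk fk1 E}.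
by have := g_bal k.+1; rewrite fk E.
Qed.

Lemma lead_left k s : f k = mk (Some s) M ->
    (if k is k'.+1 then f k' else 0) != mk (Some s) M ->
  g k = mk (Some (~~ s)) (c + M).
Proof.
move=> fk fk1; set a := (if k is _.+1 then _ else _) in fk1.
have sa : ssigned a by rewrite /a; case: (k).
have ba : sle a (SPos M) by rewrite /a; case: (k).
have [_ E] := lead_term c sa ba fk1.
apply: sbal_signed => //; first by case: s {fk fk1 E}.
by have := g_bal k; rewrite fk -/a E.
Qed.

(** Each sign is read off where its run ends: at an index holding it, before the next alternation,
    whose successor differs. There [lead_right] moves the sign one place to the right. *)
Lemma alternates_right m lo s :
  alternates f M m lo s -> alternates g (c + M) m lo.+1 s.
Proof.
elim: m lo s => [|m IH] lo s [k [lk fk /= H]].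
  (* The last run ends because [f] vanishes from [N] on. *)
  have fN : f (maxn k.+1 N) <> mk (Some s) M by rewrite f_fin ?leq_maxr //; case: (s).
  have [i [ki _ fi fi1]] := last_before fk fN (leq_maxl _ _).
  by exists i.+1; split=> //; [exact: leq_trans ki|exact: lead_right].
have [k1 [kk1 fk1 H1]] := alternates_first H.
have fk1s : f k1 <> mk (Some s) M by rewrite fk1; case: (s).
have [i [ki ik1 fi fi1]] := last_before fk fk1s kk1.
exists i.+1; split; [exact: leq_trans ki|exact: lead_right|].
exact: alternatesW (IH _ _ H1).
Qed.

(** The additional sign change comes on the left: at the first index where [f] is [mk (Some s) M],
    [lead_left] gives the opposite sign, ahead of all those supplied by [alternates_right]. *)
Lemma alternates_succ m lo s :
  alternates f M m lo s -> alternates g (c + M) m.+1 0 (~~ s).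
Proof.
move=> /alternates_first[k0 [_ fk0 H0]].
have ex : exists k, f k == mk (Some s) M by exists k0; rewrite fk0.
have [k /eqP fk kmin] := ex_minnP ex.
exists k; split=> //.
  apply: lead_left => //; case: (k) kmin => [|k'] kmin; first by case: (s).
  by apply/negP => /kmin; rewrite ltnn.
rewrite negbK; apply: alternates_right; apply: alternatesW H0.
by apply: kmin; rewrite fk0.
Qed.

End MultiplyByLinear.
End Alternation.

(** * Multiplicities of the roots of a product of linear factors *)

Section Multiplicity.
Variable G : totgrp.
Local Notation S := (smax G).
Implicit Types (a b r : S) (c x : G) (ds : seq G) (p q : spoly G) (P Q : {poly S}).

Definition linear_prod ds : {poly S} := \prod_(x <- ds) ('X + (SNeg x)%:P).

Lemma coef_linear a Q k :
  (('X + a%:P) * Q)`_k = (if k is k'.+1 then Q`_k' else 0) + a * Q`_k.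
Proof. by rewrite mulrDl coefD coefXM coefCM; case: k. Qed.

Definition has_sign (s : bool) a :=
  match a with SZero => true | SPos _ => s | SNeg _ => ~~ s | SBal _ => false end.

Lemma has_signD s a b : has_sign s a -> has_sign s b -> has_sign s (a + b).
Proof.
case: (smaxP a) => [|t x]; first by rewrite add0r.
case: (smaxP b) => [|u y]; first by rewrite addr0.
rewrite add_mk; case: ifP => // _; case: ifP => // _.
by case: s t u => [] [[]|] [[]|].
Qed.

(** As with elementary symmetric functions, the sign depends only on the parity of [size ds - k],
    which is that of [size ds + k]. Equal signs never balance, so all coefficients are signed. *)
Lemma linear_prod_sign ds k :
  has_sign (~~ odd (size ds + k)) (linear_prod ds)`_k.
Proof.
elim: ds k => [|x ds IH] k; first by rewrite /linear_prod big_nil coef1; case: k.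
rewrite /linear_prod big_cons -/(linear_prod ds) coef_linear; apply: has_signD.
  by case: k => // k; rewrite /= addnS /= negbK; exact: IH.
by have := IH k; rewrite /=; case: (_`_k) => [|y|y|y] //=; rewrite ?negbK.
Qed.

Lemma linear_prod_signed ds k : ssigned (linear_prod ds)`_k.
Proof. by have := linear_prod_sign ds k; case: (_`_k). Qed.

Lemma linear_prod_root ds r :
  sbalanced (linear_prod ds).[r] = has (fun x => sbalanced (ssub r (SPos x))) ds.
Proof.
elim: ds => [|x ds IH]; first by rewrite /linear_prod big_nil hornerC.
by rewrite /linear_prod big_cons hornerM sbalancedM -/(linear_prod ds) IH hornerD hornerX hornerC.
Qed.

Lemma linear_prod_rem ds c : c \in ds ->
  linear_prod ds = ('X + (SNeg c)%:P) * linear_prod (rem c ds).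
Proof. by move=> cds; rewrite /linear_prod (perm_big _ (perm_to_rem cds)) big_cons. Qed.

Lemma Poly_linear c : Poly [:: sopp (SPos c); sone G] = 'X + (SNeg c)%:P :> {poly S}.
Proof.
apply/polyP => k; rewrite coef_Poly coefD coefX coefC.
by case: k => [|[|k]] /=; rewrite ?add0r ?addr0 ?nth_nil.
Qed.

Lemma pcoefE p k : pcoef p k = (Poly p)`_k.
Proof. by rewrite coef_Poly. Qed.

Lemma mult_ge_linear_prod ds c p : Poly p = linear_prod ds ->
  mult_ge (SPos c) p (count_mem c ds).
Proof.
move eqm : (count_mem c ds) => m; elim: m ds p eqm => // m IH ds p eqm pE.
have cds : c \in ds by rewrite -has_pred1 has_count eqm.
split; first by rewrite /proot sbal0 pevalE pE linear_prod_root;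
  apply/hasP; exists c => //; rewrite ssub_diagP.
(* Removing one occurrence of [c] gives an exact quotient, for which balance is reflexivity. *)
exists (linear_prod (rem c ds)); split; [|split].
- by move=> k; exact: linear_prod_signed.
- move=> k; rewrite !pcoefE Poly_pmul Poly_linear polyseqK pE.
  by rewrite -linear_prod_rem // sbalxx.
apply: (IH (rem c ds)); last exact: polyseqK.
by have /seq.permP/(_ (pred1 c)) := perm_to_rem cds; rewrite eqm /= eqxx => -[].
Qed.

(* Coefficients rescaled so that the root [SPos c] becomes the unit. *)
Definition rescale c P k := P`_k * SPos c ^+ k.

Lemma rescale_signed c P k : ssigned P`_k -> ssigned (rescale c P k).
Proof.
rewrite /rescale => sP; have [x ->] : exists x, SPos c ^+ k = SPos x :> S.
  elim: k {sP} => [|k [x E]]; first by exists 0.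
  by exists (c + x); rewrite exprS E.
by case: (P`_k) sP.
Qed.

Lemma rescale_linear c a Q k : rescale c (('X + a%:P) * Q) k =
  SPos c * (if k is k'.+1 then rescale c Q k' else 0) + a * rescale c Q k.
Proof.
rewrite /rescale coef_linear mulrDl -mulrA; congr (_ + _).
by case: k => [|k]; rewrite ?mul0r ?mulr0 // exprS mulrCA.
Qed.

Lemma rescale_eq0 c P k : (rescale c P k == 0) = (P`_k == 0).
Proof.
rewrite mul_eq0; have /negbTE-> : SPos c ^+ k != 0 :> S; last by rewrite orbF.
by elim: k => // k IH; rewrite exprS mul_eq0 negb_or IH.
Qed.

Lemma rescale_max c P : (forall k, ssigned P`_k) -> P != 0 ->
  exists M s k, rescale c P k = mk (Some s) M /\ forall k, sle (rescale c P k) (SPos M).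
Proof.
move=> sP P0; have lP : rescale c P (size P).-1 != 0 by rewrite rescale_eq0 lead_coef_eq0.
have [k k0 kmax] : exists2 k, rescale c P k != 0 & forall i, (i < size P)%N ->
    sle (rescale c P i) (rescale c P k).
  (* The leading coefficient is the nonzero starting point of the search for a maximum. *)
  elim: (size P) => [|N [k k0 kmax]]; first by exists (size P).-1.
  have [Nk|kN] := boolP (sle (rescale c P N) (rescale c P k)).
    by exists k => // i; rewrite ltnS leq_eqVlt => /predU1P[->|/kmax].
  have kN' : sll (rescale c P k) (rescale c P N).
    move: kN k0; case: (smaxP (rescale c P N)) => [|t y] //.
    case: (smaxP (rescale c P k)) => [|s x] //.
    by rewrite sle_mk sll_mk; case: (trichotomyP y x).
  exists N; first by case/andP: kN'.
  move=> i; rewrite ltnS leq_eqVlt => /predU1P[->|/kmax ik]; first exact: sle_refl.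
  apply: sllW; move: ik kN'; case: (smaxP (rescale c P i)) => [|s x].
    by move=> _ /andP[]; rewrite sll0s.
  case: (smaxP (rescale c P k)) => [|t y]; first by rewrite /sle mk_neq0.
  case: (smaxP (rescale c P N)) => [|u z] //.
  by rewrite sle_mk !sll_mk; apply: le_lt_trans.
have [s [M kM]] : exists s M, rescale c P k = mk (Some s) M.
  have := rescale_signed c (sP k).
  by case: (smaxP (rescale c P k)) k0 => [|[s|] M] //; exists s, M.
exists M, s, k; split=> // i; have [iP|Pi] := ltnP i (size P).
  by have := kmax i iP; rewrite kM; case: (s); case: (rescale c P i).
by have /eqP-> : rescale c P i == 0 by rewrite rescale_eq0 nth_default.
Qed.

(** The last quotient has some coefficient of maximal weight; going back up the chain of quotients,
    [alternates_succ] gains one sign change at each step. *)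
Lemma mult_ge_alternates c m p : mult_ge (SPos c) p m ->
    (forall k, ssigned (Poly p : {poly S})`_k) -> Poly p != 0 :> {poly S} ->
  exists M s, alternates (rescale c (Poly p)) M m 0 s /\
    forall k, sle (rescale c (Poly p) k) (SPos M).
Proof.
elim: m p => [|m IH] p.
  move=> _ sp p0; have [M [s [k [kM bound]]]] := rescale_max c sp p0.
  by exists M, s; split=> //; exists k.
move=> [_ [q [sq [pq mq]]]] sp p0.
have sq' k : ssigned (Poly q : {poly S})`_k by rewrite -pcoefE; exact: sq.
have balP k : sbal (Poly p : {poly S})`_k (('X + (SNeg c)%:P) * Poly q)`_k.
  by rewrite -Poly_linear -Poly_pmul -!pcoefE; exact: pq.
(* If the quotient were zero, the signed coefficients of [p] would balance zero, hence vanish. *)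
have q0 : Poly q != 0 :> {poly S}.
  apply: contraNneq p0 => q0; apply/eqP/polyP => k.
  by apply: sbal_signed => //; have := balP k; rewrite q0 mulr0 coef0.
have [M [s [alt bound]]] := IH q mq sq' q0.
have bal k := sbalM (SPos c ^+ k) (balP k).
exists (c + M), (~~ s); split.
  apply: (alternates_succ (N := size (Poly q)) _ _ _ _ _ alt) => // k.
  - exact: rescale_signed.
  - exact: rescale_signed.
  - by move=> qk; apply/eqP; rewrite rescale_eq0 nth_default.
  - by rewrite -rescale_linear; exact: bal.
apply: (linear_bound (f := rescale c (Poly q))) => // k.
  exact: rescale_signed.
by rewrite -rescale_linear; exact: bal.
Qed.

(* In terms of Newton polygons: the horizontal length of the edge of slope [c]. *)
Lemma linear_prod_level ds c : exists M lo,
  [/\ exists s, rescale c (linear_prod ds) lo = mk s M,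
      forall k, sle (rescale c (linear_prod ds) k) (SPos M) &
      forall k, (k < lo)%N || (lo + count_mem c ds < k)%N ->
        sll (rescale c (linear_prod ds) k) (SPos M)].
Proof.
elim: ds => [|x ds [M [lo [[s loM] bound out]]]].
  exists 0, 0%N; rewrite /linear_prod big_nil /rescale.
  split=> [|k|[|k]] //; first by exists (Some true); rewrite coef1 mul1r expr0.
    by case: k => [|k]; rewrite coef1 ?mul0r // mul1r expr0 sle_refl.
  by rewrite coef1 mul0r.
set f := rescale c (linear_prod ds) in loM bound out.
have E k : rescale c (linear_prod (x :: ds)) k =
    SPos c * (if k is k'.+1 then f k' else 0) + SNeg x * f k.
  by rewrite /linear_prod big_cons rescale_linear.
have scale_le t y z a N : y + N <= z -> sle a (SPos N) -> sle (mk (Some t) y * a) (SPos z).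
  case: (smaxP a) => [|u w]; first by rewrite mulr0.
  rewrite mul_mk -![SPos _]/(mk (Some true) _) !sle_mk => yz wN.
  by apply: le_trans yz; rewrite leD2l.
have scale_lt t y z a N : y + N <= z -> sll a (SPos N) -> sll (mk (Some t) y * a) (SPos z).
  case: (smaxP a) => [|u w]; first by rewrite mulr0.
  rewrite mul_mk -![SPos _]/(mk (Some true) _) !sll_mk => yz wN.
  by apply: lt_le_trans yz; rewrite ltD2l.
have scale_lt' t y z a N : y + N < z -> sle a (SPos N) -> sll (mk (Some t) y * a) (SPos z).
  case: (smaxP a) => [|u w]; first by rewrite mulr0.
  rewrite mul_mk -![SPos _]/(mk (Some true) _) sle_mk sll_mk => yz wN.
  by apply: le_lt_trans yz; rewrite leD2l.
have f0 k : sle (if k is k'.+1 then f k' else 0) (SPos M) by case: k.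
have absorb t y a : sll a (SPos y) -> mk t y + a = mk t y.
  move=> ay; apply: sll_add; move: ay; case: (smaxP a) => [|u w]; first by rewrite !sll0s mk_neq0.
  by rewrite -[SPos y]/(mk (Some true) y) !sll_mk.
have leM y : y + M <= y + M by [].
(* A root [x] below [c] shifts the edge by one, the term in ['X] dominating; a root above [c] leaves
   it in place, the constant dominating; a root equal to [c] lengthens it by one. *)
case: (trichotomyP x c) => xc.
- have xM : x + M < c + M by rewrite ltD2r.
  exists (c + M), lo.+1; split=> [|k|k].
  + exists (sign_mul (Some true) s); rewrite E loM -[SPos c]/(mk (Some true) c) mul_mk.
    by apply: absorb; apply: (scale_lt' false) xM _.
  + rewrite E; apply: sleD; first by apply: (scale_le true) (leM c) _.
    by apply: (scale_le false) (ltW xM) _.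
  rewrite /= (lt_eqF xc) add0n => kout; rewrite E; apply: sllD; last first.
    exact: (scale_lt' false) xM _.
  case: k kout => [_|k]; first by rewrite mulr0.
  by rewrite !ltnS addSn => /out; apply: (scale_lt true) (leM c).
- have xM : c + M < x + M by rewrite ltD2r.
  exists (x + M), lo; split=> [|k|k].
  + exists (sign_mul (Some false) s); rewrite E loM addrC -[SNeg x]/(mk (Some false) x) mul_mk.
    by apply: absorb; apply: (scale_lt' true) xM _.
  + rewrite E; apply: sleD; last by apply: (scale_le false) (leM x) _.
    by apply: (scale_le true) (ltW xM) _.
  rewrite /= (gt_eqF xc) add0n => kout; rewrite E; apply: sllD.
    exact: (scale_lt' true) xM _.
  by apply: (scale_lt false) (leM x) _; exact: out.
subst x; exists (c + M), lo; split=> [|k|k].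
- exists (sign_mul (Some false) s); rewrite E loM addrC -[SNeg c]/(mk (Some false) c) mul_mk.
  (* The term to absorb comes from index [lo - 1], outside the edge, or is zero when [lo] is 0. *)
  apply: absorb; apply: (scale_lt true) (leM c) _.
  by case: (lo) out => // lo' out; apply: out; rewrite ltnSn.
- by rewrite E; apply: sleD; [apply: (scale_le true) (leM c) _|apply: (scale_le false) (leM c) _].
rewrite /= eqxx add1n => kout; rewrite E; apply: sllD.
  apply: (scale_lt true) (leM c) _; case: k kout => // k kout; apply: out.
  by case/orP: kout => [/ltnW->//|]; rewrite addnS ltnS => ->; rewrite orbT.
apply: (scale_lt false) (leM c) _; apply: out.
by case/orP: kout => [->//|]; rewrite addnS => /ltnW->; rewrite orbT.
Qed.

Lemma mult_ge_linear_prod_max ds c p m : Poly p = linear_prod ds ->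
  mult_ge (SPos c) p m -> (m <= count_mem c ds)%N.
Proof.
move=> pE mp; have [M [lo [[t loM] bound out]]] := linear_prod_level ds c.
have sp k : ssigned (Poly p : {poly S})`_k by rewrite pE linear_prod_signed.
have p0 : Poly p != 0 :> {poly S}.
  apply/eqP => p0; have /eqP : rescale c (linear_prod ds) lo == 0.
    by rewrite rescale_eq0 -pE p0 coef0.
  by rewrite loM => /eqP; rewrite mk_neq0.
have [M' [s [alt bound']]] := mult_ge_alternates mp sp p0.
rewrite pE in alt bound'; have [i [j [s' [_ ij fi fj]]]] := alternates_spread alt.
(* [M'] bounds the attained weight [M], so coefficients of modulus [M'] lie on the edge, and the [m]
   sign changes must fit in its length. *)
have MM' : M <= M'.
  by have := bound' lo; rewrite loM -[SPos M']/(mk (Some true) M') sle_mk.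
have inside k u : rescale c (linear_prod ds) k = mk u M' -> (lo <= k <= lo + count_mem c ds)%N.
  move=> fk; apply/andP; split; rewrite leqNgt; apply/negP => ko;
    have := out k; rewrite ko ?orbT fk => /(_ isT);
    by rewrite -[SPos M]/(mk (Some true) M) sll_mk => /(le_lt_trans MM'); rewrite ltxx.
have [/andP[loi _] /andP[_ jhi]] := (inside _ _ fi, inside _ _ fj).
by rewrite -(leq_add2l lo) (leq_trans _ jhi) // (leq_trans _ ij) // leq_add2r.
Qed.

Lemma smultiplicity_linear_prod ds r p : Poly p = linear_prod ds -> ssigned r ->
  smultiplicity r p (count (fun x => SPos x == r) ds).
Proof.
move=> pE sr; split.
  (* For zero or negative [r] the count is 0 and the lower bound is trivial. *)
  case: r sr => [|c|c|c] // _; first by elim: ds {pE} => //.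
    rewrite (eq_count (a2 := pred1 c)) //; exact: mult_ge_linear_prod.
  by elim: ds {pE}.
(* Either [r] comes from an element of [ds] and the sign count applies, or [r] is not a root at
   all. *)
move=> mp; have [c rE|r_notin] := pickP (fun x : seq_sub ds => SPos (ssval x) == r).
  move: mp; rewrite -(eqP rE); rewrite (eq_count (a2 := pred1 (ssval c))) //.
  by move/(mult_ge_linear_prod_max pE); rewrite ltnn.
case: mp => rp _; move: rp; rewrite /proot sbal0 pevalE pE linear_prod_root => /hasP[x xds].
by rewrite ssub_diagP // eq_sym; have := r_notin (SeqSub xds) => /= ->.
Qed.

End Multiplicity.

Theorem theorem4p12 (G : porderZmodType) (HG : div_tot_ord_group G)
    (n : nat) (A : 'M[smax G]_n) (HA : TPD A) :
  (forall g : smax G, is_seigenvalue A g <-> exists i : 'I_n, A i i = g) /\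
  (forall g : smax G, ssigned g ->
     smultiplicity g (scharpoly A) #|[set i : 'I_n | A i i == g]|).
Proof.
pose G' := Totgrp HG.
split=> g; first exact: (@is_seigenvalueE G' n A HA g).
(* The diagonal entries are positive, so their moduli determine them. *)
move=> sg; pose ds := [seq smodulus (A i i) | i <- enum 'I_n].
have diagE i : A i i = SPos (smodulus (A i i)).
  by have [x ->] := @TPD_diag G' n A HA i.
have -> : #|[set i : 'I_n | A i i == g]| = count (fun x => SPos x == g) ds.
  rewrite cardsE cardE size_filter count_map enumT; apply: eq_count => i /=.
  by rewrite -diagE.
apply: (@smultiplicity_linear_prod G') => //.
rewrite (@Poly_scharpoly G' n A HA) /linear_prod big_map big_enum.
by apply: eq_bigr => i _; rewrite {1}diagE.
Qed.
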